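(* Let $n\ge 1$ and let $k=(k_1,\ldots,k_n)$ be positive integers. For each $i=1,\ldots,n$ let $(X_i,Y_i)$ be a pair of real-valued random variables with $X_i\stackrel{d}{=}Y_i$ (possibly dependent on each other), such that the pairs $(X_i,Y_i)$ are independent as $i$ varies, and such that $X_i$ can take at most $k_i$ values. Let $f:\mathbb R^n\to\mathbb R$ be a bounded measurable function, and for $i=0,\ldots,n$ let $Z_i=f(X_1,\ldots,X_i,Y_{i+1},\ldots,Y_n)$. Then $$E(Z_n-Z_0)^2\le \rho(k)\sum_{i=1}^n E(Z_i-Z_{i-1})^2,\qquad \rho(k)\le \max_{1\le i\le n} \frac{k_i}{2}.$$
   Context: $\stackrel{d}{=}$ denotes equality in distribution. By definition $Z_0=f(Y_1,\ldots,Y_n)$ and $Z_n=f(X_1,\ldots,X_n)$. For $k\in\mathbb Z^n$ with all $k_i\ge1$, define $$\rho(k)=\max_{u,m}\frac{\sin^2\left(\sum_{i=1}^n \pi u_i/m_i\right)}{\sum_{i=1}^n\sin^2(\pi u_i/m_i)},$$ where the maximum is over all $m,u\in\mathbb Z^n$ satisfying $1\le m_i\le k_i$ and $0\le u_i<m_i$ for all $i$. The ratio is interpreted as $0$ when $u=0$ (the only case in which it is $0/0$). *)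

(* Defs.v *)
From HB Require Import structures.
From mathcomp Require Import all_boot all_order all_algebra.
From mathcomp Require Import all_classical all_reals all_analysis.

Set Implicit Arguments.
Unset Strict Implicit.
Unset Printing Implicit Defensive.

Import Order.TTheory GRing.Theory Num.Theory.

Local Open Scope classical_set_scope.
Local Open Scope ring_scope.

(* The case u = 0 has a zero denominator; since x / 0 = 0 in a field,
   the ratio is then 0, as it should be. *)
Definition sin_ratio (R : realType) (n : nat) (m u : 'I_n -> nat) : R :=
  sin (\sum_(i < n) pi * (u i)%:R / (m i)%:R) ^+ 2 /
  (\sum_(i < n) sin (pi * (u i)%:R / (m i)%:R) ^+ 2).

Definition admissible (n : nat) (k m u : 'I_n -> nat) : bool :=
  [forall i, (1 <= m i <= k i)%N] && [forall i, (u i < m i)%N].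

(* Admissible m and u satisfy u i < m i <= k i <= \max_j k j, so letting them
   range over the finite type below omits none of them.  All ratios are
   nonnegative, so the initial value 0 of the iterated maximum is harmless
   (and, when every k i is positive, it is the ratio at m = 1, u = 0). *)
Definition rho (R : realType) (n : nat) (k : 'I_n -> nat) : R :=
  \big[Num.max/0]_(p : {ffun 'I_n -> 'I_(\max_(j < n) k j).+1} *
                       {ffun 'I_n -> 'I_(\max_(j < n) k j).+1}
                   | admissible k (fun i => p.1 i) (fun i => p.2 i))
     sin_ratio R (fun i => p.1 i) (fun i => p.2 i).

Definition mutually_independent (d d' : measure_display)
    (T : measurableType d) (T' : measurableType d') (R : realType)
    (P : probability T R) (I : finType) (W : I -> T -> T') : Prop :=
  forall (J : {set I}) (B : I -> set T'), (forall i, measurable (B i)) ->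
    P (\bigcap_(i in [set` J]) W i @^-1` B i) =
    (\prod_(i in J) P (W i @^-1` B i))%E.

Definition eq_distribution (d d' : measure_display)
    (T : measurableType d) (T' : measurableType d') (R : realType)
    (P : probability T R) (X Y : {mfun T >-> T'}) : Prop :=
  forall B : set T', measurable B -> distribution P X B = distribution P Y B.

(* The number of values is a property of the law of X: exceptional values
   taken with probability 0 are not counted. *)
Definition at_most_values (d : measure_display) (T : measurableType d)
    (R : realType) (P : probability T R) (k : nat) (X : {RV P >-> R}) : Prop :=
  exists s : seq R, (size s <= k)%N /\ P (X @^-1` [set` s]) = 1%E.

(* For n variables, mixed f X Y i is f(X_1,...,X_i,Y_{i+1},...,Y_n): ordinals
   start at 0, so the j-th ordinal stands for the index j + 1. *)
Definition mixed (R : realType) (T : Type) (n : nat) (f : n.-tuple R -> R)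
    (X Y : 'I_n -> T -> R) (i : nat) : T -> R :=
  fun w => f [tuple if (j < i)%N then X j w else Y j w | j < n].

Lemma sin_ratio_ge0 (R : realType) n (m u : 'I_n -> nat) :
  0 <= sin_ratio R m u.
Proof. by rewrite divr_ge0 ?sqr_ge0 ?sumr_ge0// => i _; rewrite sqr_ge0. Qed.

Lemma sin_ratio_le_rho (R : realType) n (k m u : 'I_n -> nat) :
  admissible k m u -> sin_ratio R m u <= rho R k.
Proof.
move=> mu; have /andP[/forallP hm /forallP hu] := mu.
have bm i : (m i < (\max_(j < n) k j).+1)%N.
  by rewrite ltnS (leq_trans _ (leq_bigmax i))//; case/andP: (hm i).
have bu i : (u i < (\max_(j < n) k j).+1)%N := ltn_trans (hu i) (bm i).
pose p := ([ffun i => Ordinal (bm i)], [ffun i => Ordinal (bu i)]).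
have e1 : (fun i => p.1 i : nat) = m by apply/funext => i; rewrite ffunE.
have e2 : (fun i => p.2 i : nat) = u by apply/funext => i; rewrite ffunE.
by rewrite /rho (bigD1 p) ?e1 ?e2//= le_max lexx.
Qed.

Lemma rho_attained (R : realType) n (k : 'I_n -> nat) :
  (forall i, 0 < k i)%N ->
  exists m u, admissible k m u /\ rho R k = sin_ratio R m u.
Proof.
move=> k0; rewrite /rho; elim/big_ind: _ => [|x y|p pk].
- exists (fun=> 1%N), (fun=> 0%N); split.
    by apply/andP; split; apply/forallP => i; rewrite ?k0.
  rewrite /sin_ratio big1 ?sin0 ?expr0n ?mul0r// => i _.
  by rewrite mulr0 mul0r.
- by move=> [m [u mu]] [m' [u' mu']]; case: (leP x y) => _;
    [exists m', u' | exists m, u].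
- by exists (fun i => nat_of_ord (p.1 i)), (fun i => nat_of_ord (p.2 i)).
Qed.

(* Main.v *)
Require Import Defs.
From HB Require Import structures.
From mathcomp Require Import all_boot all_order all_algebra.
From mathcomp Require Import all_classical all_reals all_analysis.
From mathcomp Require Import measurable_realfun ring lra.
Import Order.TTheory GRing.Theory Num.Theory.
Local Open Scope classical_set_scope.
Local Open Scope ring_scope.
Import numFieldNormedType.Exports.
Set Implicit Arguments.
Unset Strict Implicit.
Unset Printing Implicit Defensive.

(** The law of the pair (X_i, Y_i) is, up to a null set, a nonnegative matrix on
    finitely many values, and X_i and Y_i having the same law says exactly that
    its row sums equal its column sums: it is a circulation.  A circulation is
    a nonnegative combination of cycles ([circulation_walks]), and a cycle runs
    through at most k_i values.  Both sides of the inequality are linear in the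
    law of each pair, by independence ([sum_prod_walks]), so each pair may be
    taken uniform on the edges of a cycle of some length m_i <= k_i.

    In that case X_i = c_i(U_i) and Y_i = c_i(U_i + 1) with the U_i independent
    and uniform on Z/m_i, and f becomes a function g on the product of the
    Z/m_i.  The differences Z_n - Z_0 and Z_i - Z_{i-1} are the increments of g
    along (1, ..., 1) and along the i-th basis vector.  By Parseval the mean
    square of the increment of g along d is the sum of the squared Fourier
    coefficients of g at u, weighted by 4 sin^2 (sum_i pi u_i d_i / m_i).
    Comparing the weights frequency by frequency gives the factor rho(k)
    ([cyclic_energy_le]), whose definition is the largest ratio of the weights.
    To treat all the m_i at once, the Fourier analysis takes place on (Z/N)^n,
    where N is a common multiple of all numbers up to max k_i; the frequencies
    u with some u_i m_i not divisible by N do not contribute, because g has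
    period m_i in the i-th variable.

    For the bound on rho(k), the point is that a nonzero |sin (pi u / m)| is at
    least 2 / m, so that sin^2 of a sum is at most the sum of the |sin|, which
    is at most max k_i / 2 times the sum of the sin^2 ([rho_le_max]). *)

(** * Lower bounds for sines and the upper bound for rho *)

(** Sine is concave on [0, pi/2]: its mean slope before x is at least its mean
    slope after x, both being values of the decreasing function cosine. *)
Lemma jordan_sin_ge (R : realType) (x : R) :
  0 <= x <= pi / 2 -> 2 * x / pi <= sin x.
Proof.
move=> /andP[x0 xpi].
have dsin (y : R) : is_derive y 1 sin (cos y) by exact: is_derive_sin.
have csin (a b : R) : {within `[a, b], continuous (@sin R)}.
  by apply: continuous_subspaceT => y; exact: continuous_sin.
have [c /andP[/= c0 cx]] := MVT_segment x0 (fun y _ => dsin y) (csin _ _).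
have [c' /andP[/= xc' c'pi]] := MVT_segment xpi (fun y _ => dsin y) (csin _ _).
rewrite sin_pihalf sin0 !subr0 => Ec' Ec.
rewrite !bnd_simp in c0 cx xc' c'pi.
have pi0 := pi_gt0 R.
have cc' : cos c' <= cos c.
  by rewrite leNgt ltr_cos ?in_itv/= -?leNgt; lra.
rewrite ler_pdivrMr//.
have : 0 <= (cos c - cos c') * (x * (pi / 2 - x)).
  by rewrite !mulr_ge0// subr_ge0.
have -> : (cos c - cos c') * (x * (pi / 2 - x)) =
   (cos c * x) * (pi / 2 - x) - cos c' * (pi / 2 - x) * x by ring.
by rewrite -Ec -Ec'; lra.
Qed.

Lemma sin_pi_frac_ge (R : realType) (u m : nat) :
  (0 < u < m)%N -> 2 / m%:R <= sin (pi * u%:R / m%:R) :> R.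
Proof.
have pi0 := pi_gt0 R.
have half (v : nat) : (0 < v)%N -> (0 < m)%N -> (v.*2 <= m)%N ->
    2 / m%:R <= sin (pi * v%:R / m%:R) :> R.
  move=> v0 m0 vm.
  have v1 : 1 <= v%:R :> R by rewrite ler1n.
  have mp : 0 < m%:R :> R by rewrite ltr0n.
  have vm' : v%:R * 2 <= m%:R :> R by rewrite -natrM ler_nat muln2.
  apply: (@le_trans _ _ (2 * (pi * v%:R / m%:R) / pi)).
    rewrite [leRHS](_ : _ = 2 * v%:R / m%:R); last by field; lra.
    by rewrite ler_pM2r ?invr_gt0//; lra.
  apply: jordan_sin_ge; apply/andP; split.
    by rewrite divr_ge0// mulr_ge0// ltW.
  rewrite ler_pdivrMr// -!mulrA ler_pM2l//; lra.
(* For u beyond m / 2, reflect: sin (pi u / m) = sin (pi (m - u) / m). *)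
move=> /andP[u0 um]; have m0 : (0 < m)%N := ltn_trans u0 um.
have [um2|um2] := leqP u.*2 m; first exact: half.
have -> : sin (pi * u%:R / m%:R) = sin (pi * (m - u)%:R / m%:R) :> R.
  have -> : pi * u%:R / m%:R = - (pi * (m - u)%:R / m%:R) + pi :> R.
    rewrite natrB 1?ltnW//; field.
    by rewrite pnatr_eq0 -lt0n.
  by rewrite sinDpi sinN opprK.
apply: half; rewrite ?subn_gt0//.
by rewrite doubleB leq_subLR -addnn leq_add2r ltnW.
Qed.

Lemma normr_sin_sum_le (R : realType) (n : nat) (a : 'I_n -> R) :
  `|sin (\sum_i a i)| <= \sum_i `|sin (a i)|.
Proof.
elim/big_ind2: _ => [|x s y t xs yt|i _]; rewrite ?sin0 ?normr0//.
rewrite sinD (le_trans (ler_normD _ _))// lerD//; rewrite normrM.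
  by rewrite (le_trans _ xs)// ler_piMr// cos_max.
by rewrite (le_trans _ yt)// ler_piMl// cos_max.
Qed.

(** Nonzero sines at multiples of pi / m are at least 2 / m in absolute value,
    so they are controlled by their own squares; since sin^2 <= |sin| and
    |sin| is subadditive, the bound on each term passes to the sum. *)
Lemma rho_le_max (R : realType) (n : nat) (k : 'I_n -> nat) :
  rho R k <= \big[Num.max/0]_(i < n) ((k i)%:R / 2).
Proof.
set c := (leRHS).
have c0 : 0 <= c by rewrite /c; exact: bigmax_ge_id.
apply/bigmax_leP; split => //= -[p q] /= /andP[/forallP pk /forallP qp].
rewrite /sin_ratio /=.
set S := \sum_(i < n) sin _ ^+ 2.
have S0 : 0 <= S by apply: sumr_ge0 => i _; exact: sqr_ge0.
have [->|Sn0] := eqVneq S 0; first by rewrite invr0 mulr0.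
rewrite ler_pdivrMr ?lt_def ?Sn0//.
set a := \sum_(i < n) _.
apply: (@le_trans _ _ `|sin a|).
  by rewrite -real_normK ?num_real// expr2 ler_piMl// sin_max.
rewrite (le_trans (normr_sin_sum_le _))// mulr_sumr ler_sum// => i _.
set s := sin _; rewrite -real_normK ?num_real// expr2 mulrA.
have [u0|u0] := posnP (q i).
  by rewrite /s u0 mulr0 mul0r sin0 normr0 mulr0.
have /andP[m1 mk] := pk i.
have m0 : 0 < (p i)%:R :> R by rewrite ltr0n.
rewrite ler_peMl//.
have mc : (p i)%:R / 2 <= c.
  rewrite (le_trans _ (le_bigmax _ _ i))//.
  by rewrite ler_pM2r// ler_nat.
have sge : 2 / (p i)%:R <= `|s|.
  by rewrite (le_trans _ (ler_norm _))// sin_pi_frac_ge// u0 qp.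
rewrite (le_trans _ (ler_pM _ _ mc sge)) ?divr_ge0//.
by rewrite [leRHS](_ : _ = 1)//; field; lra.
Qed.

(** * Fourier analysis on a power of a cyclic group *)

Section Fourier.
Variables (R : realType) (n N : nat).
Hypothesis N_gt1 : (1 < N)%N.
Let G := {ffun 'I_n -> 'Z_N}.
Implicit Types (u x y d : G) (g h : G -> R).

(** Half the argument of the character of frequency u at x: the characters are
    exp (2 i phase), and half-angles are what enters [rho]. *)
Definition phase u x : R := \sum_i pi * (u i * x i)%:R / N%:R.
Definition chic u x : R := cos (phase u x *+ 2).
Definition chis u x : R := sin (phase u x *+ 2).
Definition cos_coef h u : R := \sum_x h x * chic u x.
Definition sin_coef h u : R := \sum_x h x * chis u x.
Definition power h u : R := cos_coef h u ^+ 2 + sin_coef h u ^+ 2.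
Definition single (i : 'I_n) (a : 'Z_N) : G := [ffun j => if j == i then a else 0].

Lemma ltn_Zp (a : 'Z_N) : (a < N)%N.
Proof. by rewrite -[X in (_ < X)%N](Zp_cast N_gt1) ltn_ord. Qed.

Lemma power_ge0 h u : 0 <= power h u.
Proof. by rewrite addr_ge0 ?sqr_ge0. Qed.

Lemma phaseC u x : phase u x = phase x u.
Proof. by apply: eq_bigr => i _; rewrite mulnC. Qed.

Lemma phase0 u : phase u 0 = 0.
Proof. by rewrite /phase big1// => i _; rewrite ffunE muln0 mulr0 mul0r. Qed.

Lemma phase_single u i a : phase u (single i a) = pi * (u i * a)%:R / N%:R.
Proof.
rewrite /phase (bigD1 i)//= ffunE eqxx big1 ?addr0// => j /negPf ji.
by rewrite ffunE ji muln0 mulr0 mul0r.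
Qed.

(** The representatives in [0, N) of a sum may differ from the sum of the
    representatives by multiples of N, each worth a half-turn of the phase. *)
Lemma phaseD u x y :
  exists q : nat, phase u x + phase u y = phase u (x + y) + pi *+ q.
Proof.
have N0 : N%:R != 0 :> R by rewrite pnatr_eq0 -lt0n ltnW.
exists (\sum_i u i * ((x i + y i) %/ N))%N.
rewrite -mulr_natr natr_sum mulr_sumr -!big_split /=; apply: eq_bigr => i _.
have : (x i + y i = (x i + y i) %/ N * N + (x + y)%R i)%N.
  rewrite {1}(divn_eq (x i + y i) N) ffunE; congr (_ + _ %% _)%N.
  by rewrite Zp_cast.
move=> /(congr1 (fun z => (u i * z)%:R : R)).
rewrite !natrM !natrD natrM => E.
rewrite -mulrDl -mulrDr -mulrDr E.
by field.
Qed.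

Lemma cos_turn (a : R) (q : nat) : cos (a + pi *+ q *+ 2) = cos a.
Proof. by rewrite mulrnAC (periodicn (@cosD2pi R)). Qed.

Lemma sin_turn (a : R) (q : nat) : sin (a + pi *+ q *+ 2) = sin a.
Proof. by rewrite mulrnAC (periodicn (@sinD2pi R)). Qed.

Lemma chicD u x y :
  chic u (x + y) = chic u x * chic u y - chis u x * chis u y.
Proof.
have [q E] := phaseD u x y.
by rewrite -cosD -mulrnDl E mulrnDl cos_turn.
Qed.

Lemma chisD u x y :
  chis u (x + y) = chis u x * chic u y + chic u x * chis u y.
Proof.
have [q E] := phaseD u x y.
by rewrite -sinD -mulrnDl E mulrnDl sin_turn.
Qed.

Lemma chi_sqr u x : chic u x ^+ 2 + chis u x ^+ 2 = 1.
Proof. exact: cos2Dsin2. Qed.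

Lemma chic_half u x : 2 - chic u x *+ 2 = 4 * sin (phase u x) ^+ 2.
Proof.
rewrite /chic cos_mulr2n; have := cos2Dsin2 (phase u x); lra.
Qed.

Lemma cos_coef_shift h u d : let h' x := h (x + d) in
  cos_coef h u = cos_coef h' u * chic u d - sin_coef h' u * chis u d.
Proof.
rewrite /= /cos_coef /sin_coef (reindex_inj (addIr d)) !mulr_suml -sumrB.
by apply: eq_bigr => x _; rewrite /= chicD; ring.
Qed.

Lemma sin_coef_shift h u d : let h' x := h (x + d) in
  sin_coef h u = sin_coef h' u * chic u d + cos_coef h' u * chis u d.
Proof.
rewrite /= /cos_coef /sin_coef (reindex_inj (addIr d)) !mulr_suml -big_split.
by apply: eq_bigr => x _; rewrite /= chisD; ring.
Qed.

(** Translating by d rotates the pair of cosine and sine coefficients by the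
    argument of the character at d.  Invariance makes the pair a fixed point,
    and a nontrivial rotation fixes only the origin. *)
Lemma power_invariant h u d :
  (forall x, h (x + d) = h x) -> chic u d != 1 -> power h u = 0.
Proof.
move=> hd c1.
have E : (fun x => h (x + d)) = h by apply/funext.
have := cos_coef_shift h u d; have := sin_coef_shift h u d; rewrite /= E => sE cE.
suff /eqP : power h u * (1 - chic u d) = 0.
  by rewrite mulf_eq0 subr_eq0 [1 == _]eq_sym (negPf c1) orbF => /eqP.
have -> : power h u * (1 - chic u d) =
    cos_coef h u * (cos_coef h u - (cos_coef h u * chic u d - sin_coef h u * chis u d)) +
    sin_coef h u * (sin_coef h u - (sin_coef h u * chic u d + cos_coef h u * chis u d)).
  by rewrite /power; ring.
by rewrite -cE -sE !subrr !mulr0 addr0.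
Qed.

(** Translation by d rotates the pair of coefficients, so differencing
    multiplies its squared length by |1 - exp (2 i phase u d)|^2. *)
Lemma power_diff h u d :
  power (fun x => h x - h (x + d)) u = 4 * sin (phase u d) ^+ 2 * power h u.
Proof.
rewrite -chic_half.
have -> : power (fun x => h x - h (x + d)) u =
    (cos_coef h u - cos_coef (fun x => h (x + d)) u) ^+ 2 +
    (sin_coef h u - sin_coef (fun x => h (x + d)) u) ^+ 2.
  rewrite /power /cos_coef /sin_coef -!sumrB.
  by congr (_ ^+ 2 + _ ^+ 2); apply: eq_bigr => x _; rewrite mulrBl.
have := cos_coef_shift h u d; have := sin_coef_shift h u d; have := chi_sqr u d.
rewrite /power /=; set c := chic u d; set s := chis u d.
set a := cos_coef (fun x => h (x + d)) u; set b := sin_coef (fun x => h (x + d)) u => cs1 -> ->.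
apply/eqP; rewrite -subr_eq0.
rewrite (_ : _ - _ = (a ^+ 2 + b ^+ 2) * (2 * c - 1) * (c ^+ 2 + s ^+ 2 - 1)).
  by rewrite cs1 subrr mulr0.
by ring.
Qed.

Lemma cos_frac_eq1 (k : nat) :
  cos ((pi * k%:R / N%:R) *+ 2) = 1 :> R -> (N %| k)%N.
Proof.
have N0 : N%:R != 0 :> R by rewrite pnatr_eq0 -lt0n ltnW.
have -> : pi * k%:R / N%:R = pi * (k %% N)%:R / N%:R + pi *+ (k %/ N) :> R.
  rewrite {1}(divn_eq k N) natrD natrM -mulr_natr; by field.
rewrite mulrnDl cos_turn /dvdn => c1; rewrite eqn0Ngt; apply/negP => r0.
have : 0 < sin (pi * (k %% N)%:R / N%:R) :> R.
  rewrite (lt_le_trans _ (sin_pi_frac_ge _ _)) ?r0 ?ltn_pmod ?(ltnW N_gt1)//.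
  by rewrite divr_gt0// ltr0n ltnW.
move: c1; rewrite cos_mulr2n cos2sin2; set s := sin _ => E s0.
have : 0 < s ^+ 2 by rewrite exprn_gt0.
lra.
Qed.

(** The phase is symmetric in u and x, so this is the vanishing of a Fourier
    coefficient of the constant 1, which is invariant under any translation. *)
Lemma chic_orthogonal x : x != 0 -> \sum_u chic u x = 0.
Proof.
move=> x0; have [i xi] : exists i, x i != 0.
  apply/existsP; rewrite -negb_forall; apply: contra x0 => /forallP x0.
  by apply/eqP/ffunP => i; rewrite (eqP (x0 i)) ffunE.
have /eqP : power (fun=> 1) x = 0.
  apply: (@power_invariant _ _ (single i 1)) => //.
  apply: contra xi => /eqP; rewrite /chic phase_single => /cos_frac_eq1.
  by rewrite muln1 /dvdn modn_small ?ltn_Zp.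
rewrite paddr_eq0 ?sqr_ge0// sqrf_eq0 => /andP[/eqP E _].
rewrite -[RHS]E; apply: eq_bigr => u _.
by rewrite mul1r /chic phaseC.
Qed.

Lemma parseval h : \sum_u power h u = #|{: G}|%:R * \sum_x h x ^+ 2.
Proof.
have E u : power h u = \sum_x \sum_y h x * h y * chic u (x - y).
  rewrite /power !expr2 /cos_coef /sin_coef !mulr_suml -big_split /=.
  apply: eq_bigr => x _; rewrite !mulr_sumr -big_split /=.
  apply: eq_bigr => y _.
  have cx := chicD u (x - y) y; have sx := chisD u (x - y) y.
  rewrite !subrK in cx sx; rewrite cx sx -[RHS]mulr1 -(chi_sqr u y); ring.
under eq_bigr do rewrite E.
rewrite exchange_big mulr_sumr /=; apply: eq_bigr => x _.
rewrite exchange_big (bigD1 x)//= [X in _ + X]big1 ?addr0 => [|y yx].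
  rewrite subrr.
  under eq_bigr do rewrite /chic phase0 mul0rn cos0 mulr1.
  by rewrite sumr_const expr2 mulr_natl.
by rewrite -mulr_sumr chic_orthogonal ?mulr0// subr_eq0 eq_sym.
Qed.

Lemma sum_sqr_diff h d : #|{: G}|%:R * \sum_x (h x - h (x + d)) ^+ 2 =
  \sum_u 4 * sin (phase u d) ^+ 2 * power h u.
Proof. by rewrite -parseval; apply: eq_bigr => u _; rewrite power_diff. Qed.

(** Dividing by zero is harmless: all sin (pi u_i / m_i) vanish only for u = 0,
    and then the left side vanishes too. *)
Lemma sin_sum_le_rho (k m u : 'I_n -> nat) : admissible k m u ->
  sin (\sum_i pi * (u i)%:R / (m i)%:R) ^+ 2 <=
  rho R k * \sum_i sin (pi * (u i)%:R / (m i)%:R) ^+ 2.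
Proof.
move=> adm; have := sin_ratio_le_rho R adm; rewrite /sin_ratio.
have /andP[_ /forallP um] := adm.
set S := \sum_i _ ^+ 2.
have S0 : 0 <= S by apply: sumr_ge0 => i _; exact: sqr_ge0.
have [Sz|Sn0] := eqVneq S 0; last by rewrite ler_pdivrMr// lt_def Sn0.
move=> _; rewrite Sz mulr0 big1 ?sin0 ?expr0n// => i _.
have [->|ui] := posnP (u i); first by rewrite mulr0 mul0r.
have : sin (pi * (u i)%:R / (m i)%:R) ^+ 2 == 0 :> R.
  apply/eqP; apply: (psumr_eq0P _ Sz) => // j _; exact: sqr_ge0.
rewrite sqrf_eq0 => /eqP s0.
have := @sin_pi_frac_ge R (u i) (m i); rewrite ui um s0 => /(_ isT).
by rewrite leNgt divr_gt0// ltr0n (leq_trans _ (um i)).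
Qed.

(** After Parseval both sides are sums over frequencies u.  Where the power of
    g is nonzero, u_i / N equals v_i / m_i for an integer v_i < m_i, so the two
    weights compare as in the definition of rho. *)
Lemma cyclic_energy_le (k m : 'I_n -> nat) g :
  (forall i, 0 < m i <= k i)%N -> (forall i, m i %| N)%N ->
  (forall i x, g (x + single i (m i)%:R) = g x) ->
  \sum_x (g x - g (x + [ffun=> 1])) ^+ 2 <=
  rho R k * \sum_i \sum_x (g x - g (x + single i 1)) ^+ 2.
Proof.
move=> mk mN gm.
have N0 : N%:R != 0 :> R by rewrite pnatr_eq0 -lt0n ltnW.
have card0 : 0 < #|{: G}|%:R :> R by rewrite ltr0n; apply/card_gt0P; exists 0.
rewrite -(ler_pM2l card0) sum_sqr_diff mulrCA mulr_sumr.
under [in leRHS]eq_bigr do rewrite sum_sqr_diff.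
rewrite exchange_big mulr_sumr /=; apply: ler_sum => u _.
rewrite -mulr_suml -mulr_sumr [leRHS]mulrA.
have [->|pn0] := eqVneq (power g u) 0; first by rewrite !mulr0.
rewrite ler_wpM2r ?power_ge0// [leRHS]mulrCA ler_pM2l//.
(* g is invariant under m_i times the i-th basis vector, so the character is
   trivial there. *)
have dvd i : (N %| u i * m i)%N.
  have : chic u (single i (m i)%:R) == 1.
    by apply: contraNT pn0 => /(power_invariant (gm i))/eqP.
  rewrite /chic phase_single => /eqP/cos_frac_eq1.
  by rewrite val_Zp_nat// /dvdn modnMmr.
pose v i := (u i * m i %/ N)%N.
have vE i : (u i)%:R / N%:R = (v i)%:R / (m i)%:R :> R.
  have m0 : (m i)%:R != 0 :> R by rewrite pnatr_eq0 -lt0n; case/andP: (mk i).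
  apply/eqP; rewrite eqr_div// -!natrM; apply/eqP; congr _%:R.
  by rewrite /v divnK.
have -> : phase u [ffun=> 1] = \sum_i pi * (v i)%:R / (m i)%:R.
  by apply: eq_bigr => i _; rewrite ffunE muln1 -!mulrA vE.
under [in leRHS]eq_bigr do rewrite phase_single muln1 -mulrA vE mulrA.
apply: sin_sum_le_rho; apply/andP; split; apply/forallP => i; rewrite ?mk//.
rewrite /v ltn_divLR ?(ltnW N_gt1)// mulnC ltn_pmul2l ?ltn_Zp//.
by case/andP: (mk i).
Qed.

End Fourier.

(** * Decomposition of circulations into closed walks *)

Section Circulation.
Variables (R : realType) (S : finType) (N : nat).
Hypothesis N_gt1 : (1 < N)%N.
Implicit Types (p : S * S -> R) (x : {ffun 'Z_N -> S}).

Definition circulation p : Prop :=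
  (forall e, 0 <= p e) /\ forall a, \sum_b p (a, b) = \sum_b p (b, a).

(** Closed walks are parametrized by Z/N whatever their period m, a divisor of
    N: a cycle of length m is run through N / m times, and cycles of all lengths
    share one index set. *)
Definition step x (t : 'Z_N) : S * S := (x t, x (t + 1)).

Definition traversals x (e : S * S) : R := \sum_t (step x t == e)%:R.

Definition has_period x (m : nat) : Prop := forall t, x (t + m%:R) = x t.

Lemma traversals_ge0 x e : 0 <= traversals x e.
Proof. by apply: sumr_ge0 => t _; rewrite ler0n. Qed.

Lemma traversals_circulation x : circulation (traversals x).
Proof.
split=> [e|a]; first exact: traversals_ge0.
have pick1 (c b : S) : (\sum_d (d == c)%:R * (b == a)%:R) = (b == a)%:R :> R.
  rewrite -mulr_suml (bigD1 c)//= eqxx big1 ?addr0 ?mul1r// => d /negPf dc.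
  by rewrite dc.
transitivity (\sum_t (x t == a)%:R : R).
  rewrite exchange_big /=; apply: eq_bigr => t _.
  rewrite -[RHS](pick1 (x (t + 1))); apply: eq_bigr => b _.
  by rewrite /step xpair_eqE -natrM mulnb andbC [b == _]eq_sym.
rewrite exchange_big (reindex_inj (addIr 1)) /=; apply: eq_bigr => t _.
rewrite -[LHS](pick1 (x t)); apply: eq_bigr => b _.
by rewrite /step xpair_eqE -natrM mulnb [b == _]eq_sym.
Qed.

Lemma iter_modn (h : S -> S) v m s : iter m h v = v -> (m %| N)%N ->
  iter (s %% N) h v = iter s h v.
Proof.
move=> hv /dvdnP[c Nc].
have hm q : iter (q * m) h v = v by elim: q => // q IH; rewrite mulSn iterD IH.
by rewrite [in RHS](divn_eq s N) addnC iterD Nc mulnA hm.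
Qed.

(** From a state with positive outflow follow an edge of positive weight; its
    target has positive inflow, hence positive outflow.  Iterating this choice
    inside A repeats a state within #|A| steps. *)
Lemma closed_walk p (A : {set S}) (k : nat) e :
  circulation p -> (forall a b, p (a, b) != 0 -> a \in A) -> (#|A| <= k)%N ->
  (forall m, (0 < m <= k)%N -> (m %| N)%N) -> p e != 0 ->
  exists x, (exists2 m, (0 < m <= k)%N & has_period x m) /\
            forall t, p (step x t) != 0.
Proof.
move=> [p0 pE] pA Ak kN pe.
pose h v := odflt v [pick b | p (v, b) != 0].
have hP v b : p (v, b) != 0 -> p (v, h v) != 0.
  by rewrite /h; case: pickP => [//|/(_ b)/negbT/negPn/eqP->]; rewrite eqxx.
have hh v : p (v, h v) != 0 -> p (h v, h (h v)) != 0.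
  move=> pv; have [b /hP//|no] := pickP (fun b => p (h v, b) != 0).
  move: pv; rewrite (psumr_eq0P _ _ : forall b, true -> p (b, h v) = 0) ?eqxx//.
  by rewrite -pE big1// => b _; apply/eqP/negPn/negbT/no.
case: e pe => a b /hP pa.
have good j : p (iter j h a, iter j.+1 h a) != 0 by elim: j => //= j /hh.
have [i [j ij hij]] : exists i : 'I_#|A|.+1, exists2 j : 'I_#|A|.+1,
    i != j & iter i h a = iter j h a.
  apply/injectivePn; apply/negP => /injectiveP inj.
  have := card_imset predT inj; rewrite card_ord => cA.
  suff : (#|A|.+1 <= #|A|)%N by rewrite ltnn.
  rewrite -[X in (X <= _)%N]cA; apply: subset_leq_card; apply/fintype.subsetP => _ /imsetP[j _ ->].
  exact: pA (good j).
(* The orbit of a is periodic, of period j - i, from its i-th point on. *)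
wlog lt_ij : i j ij hij / (i < j)%N.
  by move=> W; move: (ij); rewrite neq_ltn => /orP[|] /W; apply; rewrite // eq_sym.
pose v := iter i h a; pose m := (j - i)%N.
have hv : iter m h v = v by rewrite -iterD subnK 1?ltnW.
have mk : (0 < m <= k)%N.
  by rewrite subn_gt0 lt_ij (leq_trans (leq_subr _ _))// (leq_trans _ Ak)// -ltnS.
have valD (s t : 'Z_N) : iter (s + t)%R h v = iter (s + t)%N h v.
  rewrite -[RHS](iter_modn _ hv (kN _ mk)); congr (iter (_ %% _) h v).
  exact: Zp_cast.
exists [ffun t : 'Z_N => iter t h v]; split=> [|t].
  exists m => // t; rewrite !ffunE valD val_Zp_nat// iterD.
  by rewrite (iter_modn _ hv (kN _ mk)) hv.
rewrite /step !ffunE valD [(t + _)%N](addn1 t) /v -!iterD; exact: good.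
Qed.

(** Remove from p the largest multiple of a closed walk in its support that
    keeps it nonnegative: the result is a circulation with smaller support. *)
Lemma circulation_walks p (A : {set S}) (k : nat) :
  circulation p -> (forall a b, p (a, b) != 0 -> a \in A) -> (#|A| <= k)%N ->
  (forall m, (0 < m <= k)%N -> (m %| N)%N) ->
  exists w : {ffun 'Z_N -> S} -> R,
    [/\ forall x, 0 <= w x,
        forall x, w x != 0 -> exists2 m, (0 < m <= k)%N & has_period x m
      & forall e, p e = \sum_x w x * traversals x e].
Proof.
move=> + + Ak kN; have [s] := ubnP #|[pred e | p e != 0]|.
elim: s => // s IH in p * => ps pC pA.
have [[e0 pe0]|p0] := pselect (exists e, p e != 0); last first.
  exists (fun=> 0); split=> // [x|e]; first by rewrite eqxx.
  rewrite big1 => [|x _]; last by rewrite mul0r.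
  by apply/eqP/negPn/negP => pe; apply: p0; exists e.
have [x [xm xp]] := closed_walk pC pA Ak kN pe0.
pose q := traversals x.
have q_gt0 t : 0 < q (step x t).
  rewrite /q /traversals (bigD1 t)//= eqxx.
  by apply: ltr_pwDl; rewrite ?ltr01//; apply: sumr_ge0 => j _; exact: ler0n.
have q_supp e : q e != 0 -> exists t, e = step x t.
  move=> qe; have [t /eqP<-|no] := pickP (fun t => step x t == e).
    by exists t.
  by move: qe; rewrite /q /traversals big1 ?eqxx// => t _; rewrite no.
(* The walk can be removed r t times before its t-th edge is exhausted. *)
pose r t := p (step x t) / q (step x t).
pose t0 := [arg min_(t < 0 : 'Z_N) r t]%O.
have rmin t : r t0 <= r t.
  by rewrite /t0; case: arg_minP => // i _; exact.
have c0 : 0 <= r t0 by rewrite divr_ge0 ?(pC.1) ?(ltW (q_gt0 _)).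
pose p' e := p e - r t0 * q e.
have p'0 e : 0 <= p' e.
  have [qe|/q_supp[t ->]] := eqVneq (q e) 0.
    by rewrite /p' qe mulr0 subr0 pC.1.
  by rewrite subr_ge0 -ler_pdivlMr// rmin.
have p'supp e : p' e != 0 -> p e != 0.
  have [qe|/q_supp[t ->]] := eqVneq (q e) 0; last by rewrite xp.
  by rewrite /p' qe mulr0 subr0.
have p'C : circulation p'.
  split=> // a; rewrite !sumrB -!mulr_sumr pC.2.
  by rewrite (traversals_circulation x).2.
have p'A a b : p' (a, b) != 0 -> a \in A by move/p'supp/pA.
have p's : (#|[pred e | p' e != 0%R]| < s)%N.
  rewrite -ltnS (leq_trans _ ps)// ltnS proper_card//.
  apply/properP; split; first by apply/fintype.subsetP => e; rewrite !inE; exact: p'supp.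
  exists (step x t0); rewrite !inE ?xp//.
  by rewrite /p' /r divfK ?subrr ?eqxx// gt_eqF.
have [w [w0 wm wE]] := IH _ p's p'C p'A.
exists (fun y => w y + (y == x)%:R * r t0); split=> [y|y|e].
- by rewrite addr_ge0// mulr_ge0.
- by have [->//|_] := eqVneq y x; rewrite mul0r addr0; exact: wm.
- under eq_bigr do rewrite mulrDl; rewrite big_split /= -wE.
  rewrite (bigD1 x)//= eqxx mul1r big1 ?addr0 => [|y /negPf->]; last by rewrite !mul0r.
  by rewrite /p' subrK.
Qed.

End Circulation.

(** * The inequality for finitely supported pairs *)

Section FiniteEnergy.
Variables (R : realType) (S : finType) (n : nat) (F : {ffun 'I_n -> S} -> R).

Definition mix (j : nat) (e : {ffun 'I_n -> S * S}) : {ffun 'I_n -> S} :=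
  [ffun i : 'I_n => if (i < j)%N then (e i).1 else (e i).2].

Definition gap (j l : nat) (e : {ffun 'I_n -> S * S}) : R :=
  (F (mix j e) - F (mix l e)) ^+ 2.

Definition steps (N : nat) (x : {ffun 'I_n -> {ffun 'Z_N -> S}})
    (t : {ffun 'I_n -> 'Z_N}) : {ffun 'I_n -> S * S} :=
  [ffun i => step (x i) (t i)].

(** When each pair moves uniformly along a closed walk, the gaps are increments
    of one function g on (Z/N)^n, up to a translation of the base point. *)
Lemma walks_energy_le (N : nat) (k : 'I_n -> nat)
    (x : {ffun 'I_n -> {ffun 'Z_N -> S}}) :
  (1 < N)%N -> (forall i m, 0 < m <= k i -> m %| N)%N ->
  (forall i, exists2 m, (0 < m <= k i)%N & has_period (x i) m) ->
  \sum_t gap n 0 (steps x t) <=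
  rho R k * \sum_(1 <= i < n.+1) \sum_t gap i i.-1 (steps x t).
Proof.
move=> N_gt1 kN xper; pose e := steps x.
have /choice[m mP] : forall i, exists m, (0 < m <= k i)%N /\ has_period (x i) m.
  by move=> i; have [m mk xm] := xper i; exists m.
pose g (t : {ffun 'I_n -> 'Z_N}) := F [ffun i => x i (t i)].
(* mix j advances by one step the coordinates from j on. *)
pose tail j : {ffun 'I_n -> 'Z_N} := [ffun i : 'I_n => if (i < j)%N then 0 else 1].
have mixE j t : F (mix j (e t)) = g (t + tail j).
  congr F; apply/ffunP => i; rewrite !ffunE /step.
  by case: ifP => // _; rewrite addr0.
have tail0 : tail 0%N = [ffun=> 1] by apply/ffunP => i; rewrite !ffunE.
have tailn : tail n = 0 by apply/ffunP => i; rewrite !ffunE ltn_ord.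
have tailS (i : 'I_n) : tail i = tail i.+1 + single i 1.
  apply/ffunP => j; rewrite !ffunE ltnS -val_eqE /=.
  by case: ltngtP; rewrite ?addr0 ?add0r.
have := @cyclic_energy_le R n N N_gt1 k m g (fun i => (mP i).1)
  (fun i => kN i _ (mP i).1).
have gper i t : g (t + single i (m i)%:R) = g t.
  congr F; apply/ffunP => j; rewrite !ffunE.
  by case: eqP => [->|_]; rewrite ?addr0// (mP i).2.
move=> /(_ gper) E.
rewrite big_add1 big_mkord /=.
have -> : \sum_t gap n 0 (e t) = \sum_t (g t - g (t + [ffun=> 1])) ^+ 2.
  by apply: eq_bigr => t _; rewrite /gap !mixE tailn tail0 addr0.
apply: le_trans E _; rewrite le_eqVlt; apply/orP; left; apply/eqP.
congr (_ * _); apply: eq_bigr => i _.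
rewrite [LHS](reindex_inj (addIr (tail i.+1))); apply: eq_bigr => t _ /=.
by rewrite /gap !mixE tailS addrA.
Qed.

(** Multilinearity: expanding the product of the p_i turns the expectation
    under the product law into a mixture over tuples of closed walks. *)
Lemma sum_prod_walks (N : nat) (p : 'I_n -> S * S -> R)
    (w : 'I_n -> {ffun 'Z_N -> S} -> R) (f : {ffun 'I_n -> S * S} -> R) :
  (forall i e, p i e = \sum_x w i x * traversals R x e) ->
  \sum_(e : {ffun 'I_n -> S * S}) (\prod_i p i (e i)) * f e =
  \sum_(x : {ffun 'I_n -> {ffun 'Z_N -> S}}) (\prod_i w i (x i)) *
    \sum_(t : {ffun 'I_n -> 'Z_N}) f (steps x t).
Proof.
move=> pE.
transitivity (\sum_(e : {ffun 'I_n -> S * S}) \sum_(x : {ffun 'I_n -> {ffun 'Z_N -> S}})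
    \sum_(t : {ffun 'I_n -> 'Z_N}) (\prod_i w i (x i)) *
    ((steps x t == e)%:R * f e)).
  apply: eq_bigr => e _; under eq_bigr do rewrite pE.
  rewrite bigA_distr_bigA mulr_suml; apply: eq_bigr => x _.
  rewrite big_split /= /traversals bigA_distr_bigA -mulrA -mulr_sumr.
  congr (_ * _); rewrite mulr_suml; apply: eq_bigr => t _; congr (_ * _).
  have [<-|/eqP ne] := eqVneq.
    by rewrite big1// => i _; rewrite ffunE eqxx.
  have [i si] : exists i, step (x i) (t i) != e i.
    apply/existsP; rewrite -negb_forall; apply/negP => /forallP all_eq.
    by apply: ne; apply/ffunP => i; rewrite ffunE; apply/eqP.
  by rewrite (bigD1 i)//= (negPf si) mul0r.
rewrite exchange_big; apply: eq_bigr => x _.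
rewrite exchange_big mulr_sumr; apply: eq_bigr => t _ /=.
rewrite -mulr_sumr (bigD1 (steps x t))//= eqxx mul1r.
rewrite [X in _ + X]big1 ?addr0// => e; rewrite eq_sym => /negPf->; exact: mul0r.
Qed.

Lemma finite_energy_le (k : 'I_n -> nat) (p : 'I_n -> S * S -> R)
    (A : 'I_n -> {set S}) :
  (forall i, circulation (p i)) ->
  (forall i a b, p i (a, b) != 0 -> a \in A i) ->
  (forall i, #|A i| <= k i)%N ->
  \sum_(e : {ffun 'I_n -> S * S}) (\prod_i p i (e i)) * gap n 0 e <=
  rho R k * \sum_(1 <= i < n.+1) \sum_(e : {ffun 'I_n -> S * S}) (\prod_i p i (e i)) * gap i i.-1 e.
Proof.
move=> pC pA Ak.
(* The factor 2 only ensures 1 < N, as the type 'Z_N requires. *)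
pose N := (2 * (\max_i k i)`!)%N.
have N_gt1 : (1 < N)%N by rewrite /N mul2n -addnn -addn1 leq_add ?fact_gt0.
have kN i m : (0 < m <= k i)%N -> (m %| N)%N.
  move=> /andP[m0 mk]; rewrite /N dvdn_mull// dvdn_fact// m0 (leq_trans mk)//.
  exact: leq_bigmax.
have /choice[w wP] := fun i => circulation_walks N_gt1 (pC i) (pA i) (Ak i) (kN i).
have pE i e : p i e = \sum_x w i x * traversals R x e.
  by have [_ _ ->] := wP i.
under [X in _ * X]eq_bigr do rewrite (sum_prod_walks _ pE).
rewrite (sum_prod_walks _ pE) exchange_big mulr_sumr /=; apply: ler_sum => x _.
rewrite -mulr_sumr mulrCA.
have [->|W0] := eqVneq (\prod_i w i (x i)) 0; first by rewrite !mul0r.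
rewrite ler_wpM2l//; first by apply: prodr_ge0 => i _; have [] := wP i.
apply: walks_energy_le => // i; have [_ + _] := wP i; apply.
by apply: contraNneq W0 => wi; rewrite (bigD1 i)//= wi mul0r.
Qed.

End FiniteEnergy.

(** * Reduction to finitely many atoms *)

Section Atoms.
Context {d : measure_display} {T : measurableType d} {R : realType}.
Variable P : probability T R.

Section Partition.
Variables (E : finType) (Q : E -> set T).
Hypotheses (mQ : forall e, measurable (Q e)) (tQ : trivIset setT Q).

Let U := \big[setU/set0]_(e : E) Q e.

Let mU : measurable U.
Proof. by apply: bigsetU_measurable. Qed.

Lemma probability_bigU : P U = (\sum_e P (Q e))%E.
Proof.
rewrite -[LHS]mul1e -integral_cst// /U ge0_integral_bigsetU//.
- by apply: eq_bigr => e _; rewrite integral_cst// mul1e.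
- exact: index_enum_uniq.
- exact: sub_trivIset tQ.
Qed.

Hypothesis Q1 : (\sum_e P (Q e))%E = 1%E.

Lemma probability_setC_bigU : P (~` U) = 0%E.
Proof. by rewrite probability_setC// probability_bigU Q1 subee. Qed.

(** The complement of the atoms is null, so f may be replaced by
    the simple function with the values c. *)
Lemma expectation_atoms (c : E -> R) (f : T -> R) : measurable_fun setT f ->
  (forall w, 0 <= f w) -> (forall e w, Q e w -> f w = c e) ->
  ('E_P[f])%E = (\sum_e fine (P (Q e)) * c e)%:E.
Proof.
move=> mf f0 fc.
have mEf : measurable_fun setT (EFin \o f) by exact/measurable_EFinP.
rewrite unlock.
rewrite (ge0_negligible_integral (measurableC mU) _ mEf _ probability_setC_bigU)//;
  last first.
  by move=> x _; rewrite lee_fin.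
rewrite setTD setCK /U ge0_integral_bigsetU//.
- rewrite -sumEFin; apply: eq_bigr => e _.
  rewrite (eq_integral (cst (c e)%:E)) => [|w /set_mem Qw]; last by rewrite /= (fc e).
  by rewrite integral_cst// EFinM fineK ?fin_num_measure// muleC.
- exact: index_enum_uniq.
- exact: sub_trivIset tQ.
- exact: measurable_funS mEf.
- by move=> x _; rewrite lee_fin.
Qed.

End Partition.

Lemma probability_atoms (E : finType) (Q : E -> set T) (M : set T) :
  (forall e, measurable (Q e)) -> trivIset setT Q ->
  (\sum_e P (Q e))%E = 1%E -> measurable M ->
  (\sum_e P (M `&` Q e))%E = P M.
Proof.
move=> mQ tQ Q1 mM.
have mU : measurable (\big[setU/set0]_(e : E) Q e) by apply: bigsetU_measurable.
rewrite -probability_bigU => [|e|]; [|exact: measurableI|]; last first.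
  move/trivIsetP: tQ => tQ; apply/trivIsetP => i j _ _ ij.
  by rewrite setIACA setIid tQ// setI0.
rewrite -big_distrr /= (measureDI P mM mU).
rewrite [X in _ = (X + _)%E](_ : _ = 0%E) ?add0e//.
apply: (@subset_measure0 _ _ _ P _ (~` \big[setU/set0]_(e : E) Q e)).
- exact: measurableD.
- exact: measurableC.
- by move=> x [].
- exact: probability_setC_bigU.
Qed.

End Atoms.

Section Discretization.
Context {d : measure_display} {T : measurableType d} {R : realType}.
Variable P : probability T R.

Lemma value_atoms_disjoint (X : T -> R) (t : seq R) :
  trivIset setT (fun a : seq_sub t => X @^-1` [set ssval a]).
Proof.
apply/trivIsetP => a b _ _ ab; apply/seteqP; split=> // w [/= -> E].
by move/eqP: ab; apply; exact: val_inj.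
Qed.

Lemma value_atoms_total (X : {RV P >-> R}) (s t : seq R) :
  {subset s <= t} -> P (X @^-1` [set` s]) = 1%E ->
  (\sum_(a : seq_sub t) P (X @^-1` [set ssval a]))%E = 1%E.
Proof.
move=> st Xs; rewrite -probability_bigU => [|a|].
- apply/eqP; rewrite eq_le probability_le1 /=; last first.
    by apply: bigsetU_measurable => a _; exact: measurable_funPTI.
  rewrite -Xs; apply: le_measure; rewrite ?inE.
  + apply: measurable_funPTI; apply: countable_measurable => //.
    exact/finite_set_countable/finite_seq.
  + by apply: bigsetU_measurable => a _; exact: measurable_funPTI.
  + move=> w /= Xw; rewrite -bigcup_seq.
    by exists (SeqSub (st _ Xw)) => //=; exact: mem_index_enum.
- exact: measurable_funPTI.
- exact: value_atoms_disjoint.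
Qed.

Lemma measurable_mixed (n : nat) (f : n.-tuple R -> R)
    (X Y : 'I_n -> {RV P >-> R}) (j : nat) :
  measurable_fun setT f -> measurable_fun setT (mixed f X Y j).
Proof.
move=> mf; apply: (measurableT_comp mf).
apply/measurable_fun_tnthP => i.
have -> : (tnth (T:=R))^~ i \o
    (fun w => [tuple if (i0 < j)%N then X i0 w else Y i0 w | i0 < n]) =
    if (i < j)%N then (X i : T -> R) else Y i.
  by apply/funext => w /=; rewrite tnth_mktuple; case: ifP.
by case: ifP.
Qed.

End Discretization.

Unset Implicit Arguments.

Theorem theorem5 (d : measure_display) (T : measurableType d) (R : realType)
    (P : probability T R) (n : nat) (k : 'I_n -> nat)
    (X Y : 'I_n -> {RV P >-> R}) (f : n.-tuple R -> R)
    (n_ge1 : (1 <= n)%N)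
    (k_gt0 : forall i, (0 < k i)%N)
    (XY_eqd : forall i, eq_distribution P (X i) (Y i))
    (XY_indep : mutually_independent P (fun i w => (X i w, Y i w)))
    (X_values : forall i, at_most_values (k i) (X i))
    (f_measurable : measurable_fun setT f)
    (f_bounded : exists M : R, forall x, `|f x| <= M) :
  let Z := mixed f X Y in
  ('E_P[(fun w => (Z n w - Z 0%N w) ^+ 2)%R] <=
     (rho R k)%:E *
     \sum_(1 <= i < n.+1) 'E_P[(fun w => (Z i w - Z i.-1 w) ^+ 2)%R])%E /\
  rho R k <= \big[Num.max/0]_(i < n) ((k i)%:R / 2).
Proof.
split; last exact: rho_le_max.
have /choice[s sP] : forall i, exists s : seq R,
    (size s <= k i)%N /\ P (X i @^-1` [set` s]) = 1%E by exact: X_values.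
(* One finite set S of reals carries almost surely all the X_i and Y_i. *)
pose t := flatten [seq s i | i <- enum 'I_n].
have st i : {subset s i <= t}.
  by move=> a ai; apply/flattenP; exists (s i) => //; apply/map_f/mem_enum.
pose S : finType := seq_sub t.
have ms i : measurable [set` s i].
  by apply: countable_measurable => //; exact/finite_set_countable/finite_seq.
pose EX i (a : S) := X i @^-1` [set ssval a].
pose EY i (a : S) := Y i @^-1` [set ssval a].
have mEX i a : measurable (EX i a) by exact: measurable_funPTI.
have mEY i a : measurable (EY i a) by exact: measurable_funPTI.
have tEX i : trivIset setT (EX i) by exact: value_atoms_disjoint.
have tEY i : trivIset setT (EY i) by exact: value_atoms_disjoint.
have EX1 i : (\sum_a P (EX i a) = 1)%E.
  by apply: value_atoms_total (st i) _; have [] := sP i.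
have EY1 i : (\sum_a P (EY i a) = 1)%E.
  apply: value_atoms_total (st i) _; have [_ <-] := sP i.
  by apply/esym/XY_eqd.
have EXY i a : P (EX i a) = P (EY i a) by exact: XY_eqd.
pose p i (e : S * S) := fine (P (EX i e.1 `&` EY i e.2)).
have pE i e : (p i e)%:E = P (EX i e.1 `&` EY i e.2).
  by rewrite /p fineK// fin_num_measure//; exact: measurableI.
have p_row i a : (\sum_b p i (a, b))%:E = P (EX i a).
  rewrite -sumEFin; under eq_bigr do rewrite pE.
  exact: (probability_atoms (mEY i) (tEY i) (EY1 i) (mEX i a)).
have p_col i a : (\sum_b p i (b, a))%:E = P (EY i a).
  rewrite -sumEFin; under eq_bigr do rewrite pE setIC.
  exact: (probability_atoms (mEX i) (tEX i) (EX1 i) (mEY i a)).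
(* Equality in law of X_i and Y_i is equality of row and column sums. *)
have pC i : circulation (p i).
  split=> [e|a]; first by rewrite /p fine_ge0.
  by apply: EFin_inj; rewrite p_row p_col.
pose A i : {set S} := finset (fun a : S => ssval a \in s i).
have XC i : P (~` (X i @^-1` [set` s i])) = 0%E.
  have [_ Xs] := sP i.
  by rewrite probability_setC ?Xs ?subee//; exact: measurable_funPTI.
have pA i a b : p i (a, b) != 0 -> a \in A i.
  rewrite inE; apply: contraNT => asi; apply/eqP; rewrite /p (_ : P _ = 0%E)//.
  apply: (@subset_measure0 _ _ _ P _ (~` (X i @^-1` [set` s i]))).
  - exact: measurableI.
  - by apply: measurableC; exact: measurable_funPTI.
  - by move=> w [/= -> _]; exact/negP.
  - exact: XC.
have Ak i : (#|A i| <= k i)%N.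
  have [sk _] := sP i; apply: leq_trans _ sk.
  rewrite cardE -(size_map val); apply: uniq_leq_size.
    by rewrite map_inj_uniq ?enum_uniq//; exact: val_inj.
  by move=> _ /mapP[a + ->]; rewrite mem_enum inE.
(* The atoms Q e, on which every X_i and Y_i is constant; the intersection is
   over all indices, in the form in which independence is stated. *)
pose B (e : {ffun 'I_n -> S * S}) i : set (R * R) :=
  [set ssval (e i).1] `*` [set ssval (e i).2].
pose Q (e : {ffun 'I_n -> S * S}) : set T :=
  \bigcap_(i in [set` [set: 'I_n]%SET]) (fun w => (X i w, Y i w)) @^-1` B e i.
have QP e w : Q e w -> forall i, X i w = ssval (e i).1 /\ Y i w = ssval (e i).2.
  by move=> Qw i; have /= := Qw i; rewrite inE => /(_ isT)[].
have QE e : Q e = \bigcap_(i in setT) (EX i (e i).1 `&` EY i (e i).2).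
  apply/seteqP; split=> w Qw i _; first exact: QP.
  exact: Qw.
have mQ e : measurable (Q e).
  rewrite QE; apply: fin_bigcap_measurable => // i _; exact: measurableI.
have tQ : trivIset setT Q.
  apply/trivIsetP => e e' _ _ /eqP ee'; apply/seteqP; split=> // w [Qe Qe'].
  apply: ee'; apply/ffunP => i; have [Xe Ye] := QP _ _ Qe i.
  have [Xe' Ye'] := QP _ _ Qe' i; apply/eqP; rewrite -pair_eqE /=.
  by apply/andP; split; apply/eqP/val_inj; rewrite /= -?Xe -?Ye.
have PQ e : P (Q e) = (\prod_i p i (e i))%:E.
  rewrite XY_indep => [|i]; last by apply: measurableX; exact: measurable_set1.
  rewrite -prodEFin; apply: eq_big => [i|i _]; first by rewrite inE.
  by rewrite pE.
have Q1 : (\sum_e P (Q e) = 1)%E.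
  under eq_bigr do rewrite PQ; rewrite sumEFin -bigA_distr_bigA big1// => i _.
  apply: EFin_inj; rewrite -(EX1 i).
  under [RHS]eq_bigr do rewrite -p_row.
  by rewrite sumEFin pair_bigA; congr (_%:E); apply: eq_bigr => -[].
pose F (a : {ffun 'I_n -> S}) := f [tuple ssval (a i) | i < n].
have ZF j e w : Q e w -> mixed f X Y j w = F (mix j e).
  move=> /QP Qw; congr f; apply: eq_mktuple => i; rewrite ffunE.
  by have [-> ->] := Qw i; case: ifP.
have EZ j l : ('E_P[(fun w => (mixed f X Y j w - mixed f X Y l w) ^+ 2)%R])%E =
    (\sum_(e : {ffun 'I_n -> S * S}) (\prod_i p i (e i)) * gap F j l e)%:E.
  rewrite (expectation_atoms mQ tQ Q1 (c := gap F j l)).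
  - by congr (_%:E); apply: eq_bigr => e _; rewrite PQ.
  - apply: measurable_funX; apply: measurable_funB; exact: measurable_mixed.
  - by move=> w; exact: sqr_ge0.
  - by move=> e w Qw; rewrite !(ZF _ e).
rewrite /= EZ; under eq_bigr do rewrite EZ.
rewrite sumEFin -EFinM lee_fin; exact: finite_energy_le pA Ak.
Qed.
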